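(* Let $\alpha,\beta\in\mathbb{R}$ be such that $|\alpha|\neq|\beta|$. If $p,q\in\mathbb{N}$ with $2\le q\le 2p$, then the improper integral $$\mathcal{I}_{p,q}(\alpha,\beta)=\int_0^\infty\frac{(\cos\alpha x-\cos\beta x)^p}{x^q}\,dx$$ exists (i.e. converges).
   Context: $\mathbb{N}=\{1,2,3,\ldots\}$. The integral is an improper (Riemann) integral at both endpoints: it converges (exists) if $\int_\varepsilon^R$ of the integrand tends to a finite limit as $\varepsilon\to0^+$ and $R\to\infty$ independently, and it diverges otherwise. *)

(* Defs.v *)
From Stdlib Require Import Reals.
From Coquelicot Require Import Coquelicot.
Open Scope R_scope.

Definition integrand (p q : nat) (alpha beta x : R) : R :=
  (cos (alpha * x) - cos (beta * x)) ^ p / x ^ q.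

(* [ex_RInt_gen] over the product filter of [at_right 0] and [+oo]: the integral
   over [eps, M] has a finite limit as eps -> 0+ and M -> +oo independently. *)
Definition improper_integral_converges (f : R -> R) : Prop :=
  ex_RInt_gen f (at_right 0) (Rbar_locally p_infty).

(* Main.v *)
Require Import Defs.
From Stdlib Require Import Reals Lra Lia.
From Coquelicot Require Import Coquelicot.
Open Scope R_scope.

(** The integrand is continuous on the open half-line, so only its size near
    the two endpoints matters.  Near [0] one has
    [|cos (alpha x) - cos (beta x)| <= K x^2], since both cosines are
    [1 + O(x^2)]; hence the integrand is at most [K^p x^(2p-q)], which is bounded
    because [q <= 2p].  For [x >= 1] the numerator is at most [2^p], and the
    integrand is at most [2^p / x^2] because [2 <= q].

    Both regimes fit under the single majorant [C / (1 + x)^2]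
    ([integrand_bound]).  It has the antiderivative [- C / (1 + x)], which has a
    finite limit at [0] and at [+oo], so the Cauchy criterion transfers
    convergence from the majorant to the integrand, separately at each endpoint
    ([ex_RInt_gen_dominated]); splitting the half-line at [1] concludes. *)

(** * Comparison test for improper integrals on the positive half-line *)

Section Comparison.

Variables f g G : R -> R.
Hypothesis f_continuous : forall x, 0 < x -> continuous f x.
Hypothesis g_continuous : forall x, 0 < x -> continuous g x.
Hypothesis G_derive : forall x, 0 < x -> is_derive G x (g x).
Hypothesis f_le_g : forall x, 0 < x -> Rabs (f x) <= g x.

Lemma ex_RInt_pos u v : 0 < u -> 0 < v -> ex_RInt f u v.
Proof.
  intros Hu Hv. apply (ex_RInt_continuous (V := R_CompleteNormedModule)).
  intros z [Hz _]. apply f_continuous.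
  apply Rlt_le_trans with (2 := Hz). now apply Rmin_pos.
Qed.

Lemma RInt_le_increment_ordered u v :
  0 < u -> u <= v -> Rabs (RInt f u v) <= G v - G u.
Proof.
  intros Hu Huv.
  apply (norm_RInt_le (V := R_NormedModule) f g u v).
  - exact Huv.
  - intros x Hx. apply f_le_g. lra.
  - apply (RInt_correct (V := R_CompleteNormedModule)).
    apply ex_RInt_pos; lra.
  - apply (is_RInt_derive (V := R_CompleteNormedModule) G g);
      rewrite Rmin_left by lra; intros x Hx.
    + apply G_derive. lra.
    + apply g_continuous. lra.
Qed.

Lemma RInt_le_increment u v :
  0 < u -> 0 < v -> Rabs (RInt f u v) <= Rabs (G v - G u).
Proof.
  intros Hu Hv. destruct (Rle_dec u v) as [Huv | Huv].
  - apply Rle_trans with (2 := Rle_abs _).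
    now apply RInt_le_increment_ordered.
  - rewrite <- (opp_RInt_swap f v u) by now apply ex_RInt_pos.
    change (opp (RInt f v u)) with (- RInt f v u).
    rewrite Rabs_Ropp, Rabs_minus_sym.
    apply Rle_trans with (2 := Rle_abs _).
    apply RInt_le_increment_ordered; lra.
Qed.

(** A bound on [RInt f u v] by an increment of [G] turns the Cauchy property
    of [G] along [F] into that of the primitive of [f].  Stating it for an
    arbitrary filter [F] treats both endpoints at once. *)
Lemma ex_RInt_gen_dominated (F : (R -> Prop) -> Prop) {FF : ProperFilter F}
  (c l : R) :
  0 < c -> F (fun x => 0 < x) -> filterlim G F (locally l) ->
  ex_RInt_gen f (at_point c) F.
Proof.
  intros Hc Fpos GF.
  assert (HL : exists L : R, filterlim (RInt f c) F (locally L)).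
  { apply (filterlim_locally_cauchy (U := R_CompleteSpace)).
    intros eps.
    destruct (proj2 (filterlim_locally_cauchy (U := R_CompleteSpace)
      (F := F) G) (ex_intro _ l GF) eps) as [P [FP HP]].
    exists (fun x => P x /\ 0 < x). split.
    { now apply filter_and. }
    intros u v [Pu Hu] [Pv Hv].
    change (Rabs (RInt f c v - RInt f c u) < eps).
    replace (RInt f c v - RInt f c u) with (RInt f u v).
    - apply Rle_lt_trans with (1 := RInt_le_increment u v Hu Hv).
      exact (HP u v Pu Pv).
    - rewrite <- (RInt_Chasles f c u v) by now apply ex_RInt_pos.
      symmetry. apply Rplus_minus_l. }
  destruct HL as [L HL]. exists L.
  apply filterlimi_locally. intros eps.
  apply Filter_prod with (Q := fun x => x = c)
    (R := fun x => 0 < x /\ ball L eps (RInt f c x)).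
  - reflexivity.
  - apply filter_and; [exact Fpos |].
    exact (proj1 (filterlim_locally (RInt f c) L) HL eps).
  - intros x y -> [Hy HyL]. exists (RInt f c y). split; [| exact HyL].
    apply (RInt_correct (V := R_CompleteNormedModule)). now apply ex_RInt_pos.
Qed.

End Comparison.

(** * The majorant and its antiderivative *)

Lemma is_derive_majorant C x : 0 < x ->
  is_derive (fun t => - C / (1 + t)) x (C / (1 + x) ^ 2).
Proof. intros Hx. auto_derive; [lra | field; lra]. Qed.

Lemma continuous_majorant C x : 0 < x ->
  continuous (fun t => C / (1 + t) ^ 2) x.
Proof.
  intros Hx. apply (ex_derive_continuous (V := R_NormedModule)).
  auto_derive. nra.
Qed.

Lemma filterlim_majorant_0 C :
  filterlim (fun t => - C / (1 + t)) (at_right 0) (locally (- C / (1 + 0))).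
Proof.
  apply (filterlim_filter_le_1 (F := locally 0)).
  { intros P HP. now apply filter_le_within. }
  apply (ex_derive_continuous (V := R_NormedModule) (fun t => - C / (1 + t))).
  auto_derive. lra.
Qed.

Lemma filterlim_majorant_p_infty C :
  filterlim (fun t => - C / (1 + t)) (Rbar_locally p_infty) (locally (- C * 0)).
Proof.
  apply (is_lim_scal_l (fun t => / (1 + t)) (- C) p_infty 0).
  apply (is_lim_inv (fun t => 1 + t) p_infty p_infty); [| easy].
  apply (is_lim_plus (fun _ => 1) (fun t => t) p_infty 1 p_infty).
  - apply is_lim_const.
  - apply is_lim_id.
  - easy.
Qed.

(** * Size of the integrand *)

Lemma Rabs_sin_le x : Rabs (sin x) <= Rabs x.
Proof.
  pose proof (bounded_variation sin cos 1 0 x) as H.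
  rewrite sin_0, !Rminus_0_r, Rmult_1_l in H.
  apply H. intros t _. split.
  - apply is_derive_sin.
  - apply Rabs_le, COS_bound.
Qed.

(** From [1 - cos y = 2 sin^2 (y / 2)] and [|sin z| <= |z|]. *)
Lemma cos_quadratic y : 0 <= 1 - cos y <= y ^ 2 / 2.
Proof.
  pose proof (COS_bound y) as Hcos. split; [lra |].
  replace y with (2 * (y / 2)) at 1 by field.
  rewrite cos_2a_sin.
  assert (H : (sin (y / 2))² <= (y / 2)²).
  { apply Rsqr_le_abs_1, Rabs_sin_le. }
  unfold Rsqr in H. lra.
Qed.

Lemma cos_diff_quadratic a b x :
  Rabs (cos (a * x) - cos (b * x)) <= (a ^ 2 + b ^ 2) * x ^ 2.
Proof.
  pose proof (cos_quadratic (a * x)). pose proof (cos_quadratic (b * x)).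
  apply Rabs_le. rewrite Rpow_mult_distr in *. nra.
Qed.

(** The zero of order [2p] in the numerator absorbs [x^q], leaving
    [x^(2p-q) <= 1]. *)
Lemma integrand_near_0 a b p q x : (q <= 2 * p)%nat -> 0 < x <= 1 ->
  Rabs (integrand p q a b x) <= (a ^ 2 + b ^ 2) ^ p.
Proof.
  intros Hqp Hx. unfold integrand, Rdiv.
  assert (Hxq : 0 < x ^ q) by (apply pow_lt; lra).
  rewrite Rabs_mult, Rabs_inv, (Rabs_pos_eq (x ^ q)), <- RPow_abs by lra.
  apply Rmult_le_reg_r with (x ^ q); [exact Hxq |].
  rewrite Rmult_assoc, Rinv_l, Rmult_1_r by lra.
  apply Rle_trans with (((a ^ 2 + b ^ 2) * x ^ 2) ^ p).
  - apply pow_incr. split; [apply Rabs_pos | apply cos_diff_quadratic].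
  - rewrite Rpow_mult_distr, <- pow_mult.
    apply Rmult_le_compat_l; [apply pow_le; nra |].
    replace (2 * p)%nat with (q + (2 * p - q))%nat by lia.
    rewrite pow_add.
    assert (x ^ (2 * p - q) <= 1).
    { rewrite <- (pow1 (2 * p - q)). apply pow_incr. lra. }
    nra.
Qed.

Lemma integrand_near_p_infty a b p q x : (2 <= q)%nat -> 1 <= x ->
  Rabs (integrand p q a b x) <= 2 ^ p / x ^ 2.
Proof.
  intros Hq Hx. unfold integrand, Rdiv.
  assert (Hx2 : 0 < x ^ 2) by (apply pow_lt; lra).
  assert (Hxq : x ^ 2 <= x ^ q) by now apply Rle_pow.
  rewrite Rabs_mult, Rabs_inv, (Rabs_pos_eq (x ^ q)), <- RPow_abs by lra.
  apply Rmult_le_compat.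
  - apply pow_le, Rabs_pos.
  - apply Rlt_le, Rinv_0_lt_compat. lra.
  - apply pow_incr. split; [apply Rabs_pos |].
    pose proof (COS_bound (a * x)). pose proof (COS_bound (b * x)).
    apply Rabs_le. lra.
  - now apply Rinv_le_contravar.
Qed.

(** Adding the constants of the two regimes gives one smooth majorant on the
    whole half-line, so that the comparison is made with a single
    antiderivative. *)
Lemma integrand_bound a b p q x : (2 <= q)%nat -> (q <= 2 * p)%nat -> 0 < x ->
  Rabs (integrand p q a b x)
    <= 4 * ((a ^ 2 + b ^ 2) ^ p + 2 ^ p) / (1 + x) ^ 2.
Proof.
  intros Hq Hqp Hx.
  assert (HK : 0 <= (a ^ 2 + b ^ 2) ^ p) by (apply pow_le; nra).
  assert (H2 : 0 <= 2 ^ p) by (apply pow_le; lra).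
  assert (Hd : 0 < (1 + x) ^ 2) by (apply pow_lt; lra).
  destruct (Rle_dec x 1) as [Hx1 | Hx1].
  - apply Rle_trans with ((a ^ 2 + b ^ 2) ^ p).
    { now apply integrand_near_0. }
    (* On [(0, 1]] the factor [4 / (1 + x)^2] is at least [1]. *)
    apply (proj1 (Rle_div_r _ _ _ Hd)). assert ((1 + x) ^ 2 <= 4) by nra. nra.
  - apply Rle_trans with (2 ^ p / x ^ 2).
    { apply integrand_near_p_infty; [exact Hq | lra]. }
    (* Beyond [1], [1 + x <= 2 x] gives [1 / x^2 <= 4 / (1 + x)^2]. *)
    assert (Hx2 : 0 < x ^ 2) by (apply pow_lt; lra).
    apply (proj1 (Rle_div_r _ _ _ Hd)).
    replace (2 ^ p / x ^ 2 * (1 + x) ^ 2)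
      with (2 ^ p * (1 + x) ^ 2 / x ^ 2) by (field; lra).
    apply (proj2 (Rle_div_l _ _ _ Hx2)). assert ((1 + x) ^ 2 <= 4 * x ^ 2) by nra.
    nra.
Qed.

Lemma continuous_integrand a b p q x : 0 < x ->
  continuous (integrand p q a b) x.
Proof.
  intros Hx. apply (ex_derive_continuous (V := R_NormedModule)).
  unfold integrand. auto_derive. apply pow_nonzero. lra.
Qed.

(** * Convergence *)

Theorem theorem3p10 (alpha beta : R) (hab : Rabs alpha <> Rabs beta)
  (p q : nat) (hp : (1 <= p)%nat) (hq : (1 <= q)%nat)
  (h2q : (2 <= q)%nat) (hqp : (q <= 2 * p)%nat) :
  improper_integral_converges (integrand p q alpha beta).
Proof.
  unfold improper_integral_converges.
  set (C := 4 * ((alpha ^ 2 + beta ^ 2) ^ p + 2 ^ p)).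
  pose proof (ex_RInt_gen_dominated (integrand p q alpha beta)
    (fun x => C / (1 + x) ^ 2) (fun x => - C / (1 + x))
    (continuous_integrand alpha beta p q) (continuous_majorant C)
    (is_derive_majorant C)
    (fun x => integrand_bound alpha beta p q x h2q hqp)) as Hdom.
  apply (ex_RInt_gen_Chasles (integrand p q alpha beta) 1).
  - destruct (Hdom (at_right 0) _ 1 (- C / (1 + 0))) as [L HL].
    + lra.
    + exists (mkposreal 1 Rlt_0_1). now intros y _ Hy.
    + apply filterlim_majorant_0.
    + exists (opp L). now apply is_RInt_gen_swap; try typeclasses eauto.
  - apply (Hdom (Rbar_locally p_infty) _ 1 (- C * 0)).
    + lra.
    + now exists 0.
    + apply filterlim_majorant_p_infty.
Qed.
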